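(* Let $n>4$ and let $f,g:C_n\to C_n$ be continuous selfmaps of the digital cycle $C_n$. Then $f_{*,q}=g_{*,q}:H_q(C_n)\to H_q(C_n)$ for each $q\ge 0$ if and only if $f\simeq g$ (that is, $f$ and $g$ are digitally homotopic).
   Context: A digital image is a set $X$ together with a symmetric, antireflexive adjacency relation (equivalently, a simple graph). Write $x\leftrightarrow x'$ for ''adjacent'' and $x\mathrel{\underline{\leftrightarrow}} x'$ for ''adjacent or equal''. A function $f:X\to Y$ between digital images is continuous if $x\leftrightarrow x'$ implies $f(x)\mathrel{\underline{\leftrightarrow}} f(x')$. For integers $a\le b$, $[a,b]_{\mathbb Z}=\{a,\dots,b\}$, where $s,t$ are adjacent iff $|s-t|=1$. The digital cycle is $C_n=\{c_0,\dots,c_{n-1}\}$ with adjacencies exactly $c_i\leftrightarrow c_{i+1}$ for each $i$, subscripts read modulo $n$. Homotopy ($\simeq$): continuous $f,g:X\to Y$ are homotopic, $f\simeq g$, if for some positive integer $k$ there is $H:X\times[0,k]_{\mathbb Z}\to Y$ with $H(x,0)=f(x)$, $H(x,k)=g(x)$ for all $x$, such that $t\mapsto H(x,t)$ is continuous for each fixed $x$ and $x\mapsto H(x,t)$ is continuous for each fixed $t$. Digital homology (the simplicial homology of the clique complex): a $q$-simplex of $X$ is a set of $q+1$ mutually adjacent points, written $\langle x_0,\dots,x_q\rangle$. The chain group $C_q(X)$ (not to be confused with the cycle $C_n$) is the free abelian group generated by the $q$-simplices, with the identification $\langle x_0,\dots,x_q\rangle=(-1)^\rho\langle x_{\rho(0)},\dots,x_{\rho(q)}\rangle$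 for permutations $\rho$, where $(-1)^\rho$ is the sign of $\rho$. The boundary $\partial_q:C_q(X)\to C_{q-1}(X)$ is given by $\partial_q\langle x_0,\dots,x_q\rangle=\sum_{i=0}^q(-1)^i\langle x_0,\dots,\widehat{x_i},\dots,x_q\rangle$ (with $\partial_0=0$). Put $Z_q(X)=\ker\partial_q$, $B_q(X)=\operatorname{im}\partial_{q+1}$, $H_q(X)=Z_q(X)/B_q(X)$. A continuous $f:X\to Y$ induces $f_\#:C_q(X)\to C_q(Y)$, $f_\#\langle x_0,\dots,x_q\rangle=\langle f(x_0),\dots,f(x_q)\rangle$, interpreted as $0$ if the points $f(x_0),\dots,f(x_q)$ are not all distinct, and hence a homomorphism $f_{*,q}:H_q(X)\to H_q(Y)$. *)

(* Defs.v *)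
From HB Require Import structures.
From mathcomp.multinomials Require Import freeg.
From mathcomp Require Import all_fingroup.
From mathcomp Require Import all_boot all_algebra.
From mathcomp Require Import zify.
From mathcomp.classical Require Import boolp.

Set Implicit Arguments.
Unset Strict Implicit.
Unset Printing Implicit Defensive.

Import GRing.Theory.
Local Open Scope ring_scope.
Local Open Scope quotient_scope.

Record digital_image := DigitalImage {
  point :> choiceType;
  adj : rel point;
  adj_sym : symmetric adj;
  adj_irr : irreflexive adj }.

Definition adjeq (X : digital_image) (x y : X) : bool := (x == y) || adj x y.

Definition dcontinuous (X Y : digital_image) (f : X -> Y) : Prop :=
  forall x x' : X, adj x x' -> adjeq (f x) (f x').

Section Interval.
Variable k : nat.
Definition interval_adj : rel 'I_k.+1 := fun s t => `|s%:Z - t%:Z|%N == 1%N.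
Lemma interval_adj_sym : symmetric interval_adj.
Proof. by move=> s t; rewrite /interval_adj distnC. Qed.
Lemma interval_adj_irr : irreflexive interval_adj.
Proof. by move=> s; rewrite /interval_adj distnn. Qed.
Definition interval : digital_image :=
  DigitalImage interval_adj_sym interval_adj_irr.
End Interval.

(* The condition [i != j] only matters for [n = 1], where it rules out a loop
   at the single point. *)
Section Cycle.
Variable n : nat.
Definition cycle_adj : rel 'I_n := fun i j =>
  (i != j) && ((j == i.+1 %[mod n])%N || (i == j.+1 %[mod n])%N).
Lemma cycle_adj_sym : symmetric cycle_adj.
Proof. by move=> i j; rewrite /cycle_adj eq_sym orbC. Qed.
Lemma cycle_adj_irr : irreflexive cycle_adj.
Proof. by move=> i; rewrite /cycle_adj eqxx. Qed.
Definition digital_cycle : digital_image :=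
  DigitalImage cycle_adj_sym cycle_adj_irr.
End Cycle.

Definition homotopic (X Y : digital_image) (f g : X -> Y) : Prop :=
  exists2 k : nat, (0 < k)%N & exists H : X -> interval k -> Y,
    [/\ forall x, H x ord0 = f x,
        forall x, H x ord_max = g x,
        forall x, @dcontinuous (interval k) Y (H x) &
        forall t, dcontinuous (H ^~ t)].

Definition generated (M : zmodType) (S : M -> Prop) : {pred M} := fun x =>
  `[< forall G : M -> Prop, G 0 -> (forall a b, G a -> G b -> G (a - b)) ->
      (forall s, S s -> G s) -> G x >].

Lemma generated_zmod (M : zmodType) (S : M -> Prop) :
  zmod_closed (generated S).
Proof.
split; first by apply/asboolP => G G0 _ _; exact: G0.
move=> x y /asboolP hx /asboolP hy; apply/asboolP => G G0 GB GS.
by apply: (GB); [exact: hx | exact: hy].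
Qed.
HB.instance Definition _ (M : zmodType) (S : M -> Prop) :=
  GRing.isZmodClosed.Build M (generated S) (generated_zmod S).

Lemma generatedW (M : zmodType) (S : M -> Prop) x : S x -> x \in generated S.
Proof. by move=> Sx; apply/asboolP => G _ _ GS; exact: GS. Qed.

(* Only meaningful when [phi] vanishes on [I]. *)
Definition quot_lift (M N : zmodType) (I : zmodClosed M) (phi : M -> N)
  (x : {ideal_quot I}) : N := phi (repr x).

Lemma quot_liftE (M N : zmodType) (I : zmodClosed M) (phi : {additive M -> N}) :
  (forall x, x \in I -> phi x = 0) ->
  forall x, quot_lift phi (\pi_{ideal_quot I} x) = phi x.
Proof.
move=> phi0 x; apply/eqP; rewrite -subr_eq0 -raddfB; apply/eqP/phi0.
by rewrite Quotient.idealrBE reprK.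
Qed.

(* [fglift] wants a Z-module; [zmodule M] is the abelian group M seen as one. *)
Definition free_lift (K : choiceType) (M : zmodType) (phi : K -> M)
  (c : {freeg K / int}) : M := fglift (phi : K -> zmodule M) c.

Lemma free_lift_zmod (K : choiceType) (M : zmodType) (phi : K -> M) :
  zmod_morphism (free_lift phi).
Proof. by move=> c d; exact: (lift_is_additive (M := zmodule M)). Qed.
HB.instance Definition _ (K : choiceType) (M : zmodType) (phi : K -> M) :=
  GRing.isZmodMorphism.Build {freeg K / int} M (free_lift phi)
    (free_lift_zmod phi).

Lemma free_liftU (K : choiceType) (M : zmodType) (phi : K -> M) x :
  free_lift phi << x >> = phi x.
Proof. by rewrite /free_lift liftU scale1r. Qed.

Definition tuple_perm (T : Type) n (t : n.-tuple T) (rho : 'S_n) : n.-tuple T :=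
  [tuple tnth t (rho i) | i < n].

Definition face (T : Type) n (t : n.+1.-tuple T) (i : 'I_n.+1) : n.-tuple T :=
  [tuple tnth t (lift i j) | j < n].

Section Chains.
Variables (X : digital_image) (q : nat).

Definition mutually_adj (t : q.+1.-tuple X) : bool :=
  [forall i, forall j, (i != j) ==> adj (tnth t i) (tnth t j)].

(* Simplices with an ordering of their vertices; [chain_rel] below identifies
   the orderings up to sign. *)
Record simplex := Simplex {
  vertices :> q.+1.-tuple X;
  _ : mutually_adj vertices }.
HB.instance Definition _ := [isSub for vertices].
HB.instance Definition _ := [Choice of simplex by <:].

Definition chain_rel (r : {freeg simplex / int}) : Prop :=
  exists (s s' : simplex) (rho : 'S_q.+1),
    vertices s' = tuple_perm s rho /\ r = << s >> - << s' >> *~ (-1) ^+ rho.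

Definition chain : zmodType := {ideal_quot (generated chain_rel)}.

(* The oriented simplex <x_0, ..., x_q>; it is 0 when the points are not
   mutually adjacent. *)
Definition oriented (t : q.+1.-tuple X) : chain :=
  if insub t is Some s then \pi_chain << s >> else 0.

End Chains.

Section TuplePerm.
Variables (T : Type) (n : nat).

Lemma tuple_permM (t : n.-tuple T) (r s : 'S_n) :
  tuple_perm (tuple_perm t r) s = tuple_perm t (s * r)%g.
Proof. by apply: eq_from_tnth => i; rewrite !tnth_mktuple permM. Qed.

Lemma tuple_perm1 (t : n.-tuple T) : tuple_perm t 1%g = t.
Proof. by apply: eq_from_tnth => i; rewrite tnth_mktuple perm1. Qed.

Lemma lift_permE (rho : 'S_n.+1) (i : 'I_n.+1) :
  exists s : 'S_n, rho = lift_perm i (rho i) s.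
Proof.
pose f k := odflt k (unlift (rho i) (rho (lift i k))).
have fE k : lift (rho i) (f k) = rho (lift i k).
  rewrite /f; have := neq_lift i k.
  by rewrite -(can_eq (permK rho)) => /unlift_some[] ? ? ->.
have f_inj : injective f.
  move=> k l /(congr1 (lift (rho i))); rewrite !fE => /perm_inj.
  exact: lift_inj.
exists (perm f_inj); apply/perm.permP => k.
case: (unliftP i k) => [k'|] ->; rewrite ?lift_perm_id //.
by rewrite lift_perm_lift permE fE.
Qed.

Lemma face_perm (t : n.+1.-tuple T) i j (s : 'S_n) :
  face (tuple_perm t (lift_perm i j s)) i = tuple_perm (face t j) s.
Proof. by apply: eq_from_tnth => k; rewrite !tnth_mktuple lift_perm_lift. Qed.

End TuplePerm.

Section Oriented.
Variables (X : digital_image) (q : nat).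
Implicit Types (t : q.+1.-tuple X) (s : simplex X q).

Lemma mutually_adjP t :
  reflect (forall i j : 'I_q.+1, i != j -> adj (tnth t i) (tnth t j)) (mutually_adj t).
Proof.
apply: (iffP forallP) => [h i j ne|h i].
  by move/forallP: (h i) => /(_ j) /implyP; apply.
by apply/forallP => j; apply/implyP => /h.
Qed.

Lemma mutually_adj_perm t (rho : 'S_q.+1) :
  mutually_adj (tuple_perm t rho) = mutually_adj t.
Proof.
have H (u : q.+1.-tuple X) (r : 'S_q.+1) : mutually_adj u -> mutually_adj (tuple_perm u r).
  move=> /mutually_adjP h; apply/mutually_adjP => i j ne.
  by rewrite !tnth_mktuple h // (inj_eq perm_inj).
apply/idP/idP => [|/H //]; rewrite -[t in X in _ -> X](tuple_perm1 t).
by rewrite -(mulVg rho) -tuple_permM; exact: H.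
Qed.

Lemma mutually_adj_uniq t : mutually_adj t -> uniq t.
Proof.
move=> /mutually_adjP h; apply/tuple_uniqP => i j eij; apply/eqP.
by apply/negPn/negP => /h; rewrite eij adj_irr.
Qed.

Lemma orientedE s : oriented s = \pi_(chain X q) << s >>.
Proof.
rewrite /oriented insubT ?valP // => h.
by congr (\pi << _ >>); apply: val_inj.
Qed.

Lemma oriented0 t : ~~ mutually_adj t -> oriented t = 0.
Proof. by move=> h; rewrite /oriented insubF //; apply/negbTE. Qed.

Lemma oriented_perm t (rho : 'S_q.+1) :
  oriented t = oriented (tuple_perm t rho) *~ (-1) ^+ rho.
Proof.
have [h|h] := boolP (mutually_adj t); last first.
  by rewrite !oriented0 ?mutually_adj_perm // mul0rz.
have h' : mutually_adj (tuple_perm t rho) by rewrite mutually_adj_perm.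
rewrite (orientedE (Simplex h)) (orientedE (Simplex h')).
rewrite -raddfMz; apply/eqP; rewrite -subr_eq0 -raddfB.
rewrite -[X in _ == X](raddf0 (\pi_(chain X q))) -Quotient.idealrBE subr0.
by apply: generatedW; exists (Simplex h), (Simplex h'), rho.
Qed.

Variables (M : zmodType) (phi : simplex X q -> M).
Definition chain_lift : chain X q -> M := quot_lift (free_lift phi).

Hypothesis phi_alt : forall s s' (rho : 'S_q.+1),
  vertices s' = tuple_perm s rho -> phi s = phi s' *~ (-1) ^+ rho.

Let lift_rel x : x \in generated (@chain_rel X q) -> free_lift phi x = 0.
Proof.
move=> /asboolP h; apply: (h (fun x => free_lift phi x = 0)).
- exact: raddf0.
- by move=> a b ha hb; rewrite raddfB /= ha hb subrr.
move=> _ [s [s' [rho [E ->]]]].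
by rewrite raddfB raddfMz /= !free_liftU (phi_alt E) subrr.
Qed.

Lemma chain_lift_zmod : zmod_morphism chain_lift.
Proof.
move=> x y; rewrite -[x]reprK -[y]reprK -raddfB /chain_lift.
by rewrite !(quot_liftE lift_rel) raddfB.
Qed.

Lemma chain_lift_oriented s : chain_lift (oriented s) = phi s.
Proof. by rewrite orientedE /chain_lift (quot_liftE lift_rel) /= free_liftU. Qed.

End Oriented.

Lemma chain_ext (X : digital_image) q (M : zmodType)
  (phi psi : {additive chain X q -> M}) :
  (forall s : simplex X q, phi (oriented s) = psi (oriented s)) -> phi =1 psi.
Proof.
move=> h x; rewrite -[x]reprK -[repr x]freeg_sumE !raddf_sum.
apply: eq_bigr => s _; rewrite -[coeff _ _]intz -freegU_mulz !raddfMz.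
by congr (_ *~ _); have := h s; rewrite orientedE.
Qed.

Section Boundary.
Variables (X : digital_image) (q : nat).
Implicit Types (t : q.+2.-tuple X) (s : simplex X q.+1).

Definition bd_tuple t : chain X q :=
  \sum_(i < q.+2) oriented (face t i) *~ (-1) ^+ i.

Lemma bd_tuple_perm t (rho : 'S_q.+2) :
  bd_tuple t = bd_tuple (tuple_perm t rho) *~ (-1) ^+ rho.
Proof.
rewrite /bd_tuple mulrz_suml (reindex_inj (@perm_inj _ rho)).
apply: eq_bigr => i _; have [s] := lift_permE rho i.
move: (rho i) => j ->; rewrite face_perm (oriented_perm _ s) -!mulrzA.
congr (_ *~ _); rewrite odd_lift_perm -[(-1) ^+ j]signr_odd.
rewrite -[(-1) ^+ i]signr_odd.
by move: (odd_perm s) (odd i) (odd j) => [] [] [].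
Qed.

Definition bd_simplex s : chain X q := bd_tuple s.

Lemma bd_simplex_alt s s' (rho : 'S_q.+2) :
  vertices s' = tuple_perm s rho -> bd_simplex s = bd_simplex s' *~ (-1) ^+ rho.
Proof. by rewrite /bd_simplex => ->; exact: bd_tuple_perm. Qed.

Definition boundaryS : chain X q.+1 -> chain X q := chain_lift bd_simplex.

HB.instance Definition _ := GRing.isZmodMorphism.Build _ _ boundaryS
  (chain_lift_zmod bd_simplex_alt).

Lemma boundaryS_oriented s : boundaryS (oriented s) = bd_tuple s.
Proof. exact: (chain_lift_oriented bd_simplex_alt). Qed.

End Boundary.

Section BoundaryFacts.
Variable X : digital_image.

Lemma mutually_adj_face q (t : q.+2.-tuple X) i :
  mutually_adj t -> mutually_adj (face t i).
Proof.
move=> /mutually_adjP h; apply/mutually_adjP => j k ne.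
by rewrite !tnth_mktuple h // (inj_eq lift_inj).
Qed.

Lemma bd_tuple_dup q (t : q.+2.-tuple X) a b :
  a != b -> tnth t a = tnth t b -> bd_tuple t = 0.
Proof.
move=> ab tab; have tE : tuple_perm t (tperm a b) = t.
  by apply: eq_from_tnth => i; rewrite tnth_mktuple; case: tpermP => // ->.
rewrite /bd_tuple (bigD1 a) //= (bigD1 b) 1?eq_sym //= big1 ?addr0; last first.
  move=> k /andP[ka kb]; rewrite oriented0 ?mul0rz //.
  apply/negP => /mutually_adj_uniq /tuple_uniqP inj.
  have [a' ea _] := unlift_some ka; have [b' eb _] := unlift_some kb.
  suff /inj e : tnth (face t k) a' = tnth (face t k) b'.
    by move: ab; rewrite ea eb e eqxx.
  by rewrite !tnth_mktuple -ea -eb.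
have [s] := lift_permE (tperm a b) a; rewrite tpermL => es.
have := odd_tperm a b; rewrite es odd_lift_perm ab.
rewrite -{1}tE es face_perm [in X in _ + X](oriented_perm _ s) -mulrzA.
rewrite -mulrzDr -[(-1) ^+ a]signr_odd -[(-1) ^+ b]signr_odd.
by move: (odd_perm s) (odd a) (odd b) => [] [] [].
Qed.

Lemma boundaryS_tuple q (t : q.+2.-tuple X) :
  mutually_adj t -> boundaryS (oriented t) = bd_tuple t.
Proof. by move=> h; exact: (boundaryS_oriented (Simplex h)). Qed.

Lemma boundaryK q (c : chain X q.+2) : boundaryS (boundaryS c) = 0.
Proof.
apply: (@chain_ext _ _ _ (@boundaryS X q \o @boundaryS X q.+1) \0) c => s /=.
rewrite boundaryS_oriented raddf_sum /=.
pose G i j := oriented (face (face s i) j) *~ ((-1) ^+ j * (-1) ^+ i).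
under eq_bigr => i _.
  rewrite raddfMz /= boundaryS_tuple ?mutually_adj_face ?(valP s) //.
  rewrite /bd_tuple mulrz_suml; under eq_bigr do rewrite -mulrzA -/(G i _).
  over.
rewrite pair_bigA /= (bigID (fun p : 'I_q.+3 * 'I_q.+2 => p.1 <= p.2)%N) /=.
pose h (p : 'I_q.+3 * 'I_q.+2) : 'I_q.+3 * 'I_q.+2 :=
  if (p.1 <= p.2)%N then (inord p.2.+1, inord p.1) else (inord p.2, inord p.1.-1).
have h1 (i : 'I_q.+3) (j : 'I_q.+2) : (i <= j)%N ->
    [/\ ((h (i, j)).1 = j.+1 :> nat), ((h (i, j)).2 = i :> nat) &
        h (h (i, j)) = (i, j)].
  move=> ij; have e1 : (inord j.+1 : 'I_q.+3) = j.+1 :> nat by rewrite inordK // ltnS ltn_ord.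
  have e2 : (inord i : 'I_q.+2) = i :> nat.
    by rewrite inordK //; exact: leq_ltn_trans ij (ltn_ord j).
  rewrite /h /= ij; split=> //=; rewrite e1 e2 ltnNge ij /=.
  by rewrite !inord_val.
have h2 (i : 'I_q.+3) (j : 'I_q.+2) : (j < i)%N ->
    ((h (i, j)).1 <= (h (i, j)).2)%N /\ h (h (i, j)) = (i, j).
  move=> ji; have i0 : (0 < i)%N by exact: leq_ltn_trans ji.
  have e1 : (inord j : 'I_q.+3) = j :> nat by rewrite inordK // ltnS ltnW.
  have e2 : (inord i.-1 : 'I_q.+2) = i.-1 :> nat.
    by rewrite inordK // -ltnS prednK.
  have le : (j <= i.-1)%N by rewrite -ltnS prednK.
  have nij : (i <= j)%N = false by rewrite leqNgt ji.
  rewrite /h /= nij /=; rewrite e1 e2 le; split=> //.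
  by rewrite prednK // !inord_val.
rewrite addrC (reindex_onto h h) /=; last first.
  by move=> [i j]; rewrite -ltnNge => /h2[].
rewrite (eq_bigl (fun p : 'I_q.+3 * 'I_q.+2 => p.1 <= p.2)%N); last first.
  move=> [i j]; have [ij|ji] := leqP i j.
    by have [-> -> ->] := h1 _ _ ij; rewrite -ltnNge ltnS ij eqxx.
  by have [-> _] := h2 _ _ ji.
rewrite -big_split big1 //= => -[i j] /= ij; rewrite /G.
have [e1 e2 _] := h1 _ _ ij.
have -> : face (face s (h (i, j)).1) (h (i, j)).2 = face (face s i) j.
  apply: eq_from_tnth => k; rewrite !tnth_mktuple; congr tnth.
  apply: val_inj; rewrite /= e1 e2 /bump.
  move: ij; lia.
by rewrite -mulrzDr e1 e2 exprS mulN1r mulrN [X in - X + _]mulrC addNr.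
Qed.

End BoundaryFacts.

Definition boundary (X : digital_image) (q : nat) : chain X q -> chain X q.-1 :=
  if q is p.+1 then @boundaryS X p else fun=> 0.

Lemma boundary_zmod (X : digital_image) (q : nat) :
  zmod_morphism (@boundary X q).
Proof. by case: q => [|q] x y; rewrite ?subrr //; exact: raddfB. Qed.
HB.instance Definition _ (X : digital_image) (q : nat) :=
  GRing.isZmodMorphism.Build _ _ (@boundary X q) (@boundary_zmod X q).

Section Homology.
Variables (X : digital_image) (q : nat).

Definition is_cycle : {pred chain X q} := fun c => boundary c == 0.
Lemma is_cycle_zmod : zmod_closed is_cycle.
Proof.
split=> [|x y]; rewrite !unfold_in ?raddf0 // => /eqP hx /eqP hy.
by rewrite raddfB /= hx hy subrr.
Qed.
HB.instance Definition _ :=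
  GRing.isZmodClosed.Build (chain X q) is_cycle is_cycle_zmod.

Record cycles := Cycles { cycle_chain :> chain X q; _ : cycle_chain \in is_cycle }.
HB.instance Definition _ := [isSub for cycle_chain].
HB.instance Definition _ := [Choice of cycles by <:].
HB.instance Definition _ := [SubChoice_isSubZmodule of cycles by <:].

(* All of im d_{q+1}, viewed inside Z_q: see [boundaryK]. *)
Definition is_boundary : {pred cycles} := fun z =>
  `[< exists w : chain X q.+1, boundary w = cycle_chain z >].
Lemma is_boundary_zmod : zmod_closed is_boundary.
Proof.
split; first by apply/asboolP; exists 0; rewrite raddf0.
move=> x y /asboolP[v hv] /asboolP[w hw]; apply/asboolP; exists (v - w).
by rewrite [LHS]raddfB [RHS]/= -hv -hw.
Qed.
HB.instance Definition _ :=
  GRing.isZmodClosed.Build cycles is_boundary is_boundary_zmod.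

Definition homology : zmodType := {ideal_quot is_boundary}.

End Homology.

Section ChainMap.
Variables (X Y : digital_image) (f : X -> Y).

Lemma oriented_map_alt q (s s' : simplex X q) (rho : 'S_q.+1) :
  vertices s' = tuple_perm s rho ->
  oriented (map_tuple f s) = oriented (map_tuple f s') *~ (-1) ^+ rho.
Proof.
move=> ->; rewrite (oriented_perm _ rho); congr (oriented _ *~ _).
by apply: eq_from_tnth => i; rewrite !(tnth_mktuple, tnth_map).
Qed.

(* By [mutually_adj_map] below, for a continuous [f] the value is 0 exactly on
   the simplices whose vertices do not have distinct images. *)
Definition chain_map q : chain X q -> chain Y q :=
  chain_lift (fun s => oriented (map_tuple f s)).
HB.instance Definition _ q := GRing.isZmodMorphism.Build _ _ (@chain_map q)
  (chain_lift_zmod (@oriented_map_alt q)).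

Lemma chain_map_oriented q (s : simplex X q) :
  chain_map (oriented s) = oriented (map_tuple f s).
Proof. exact: (chain_lift_oriented (@oriented_map_alt q)). Qed.

Lemma chain_map_tuple q (t : q.+1.-tuple X) :
  mutually_adj t -> chain_map (oriented t) = oriented (map_tuple f t).
Proof. by move=> h; exact: (chain_map_oriented (Simplex h)). Qed.

Hypothesis fc : dcontinuous f.

Lemma mutually_adj_map q (s : simplex X q) :
  mutually_adj (map_tuple f s) = uniq (map_tuple f s).
Proof.
apply/idP/idP => [/mutually_adj_uniq //|/tuple_uniqP u].
apply/mutually_adjP => i j ne; rewrite !tnth_map.
have /mutually_adjP/(_ i j ne)/fc/orP[/eqP e|//] := valP s.
by case/eqP: ne; apply: u; rewrite !tnth_map.
Qed.

Lemma chain_map_boundaryS q (c : chain X q.+1) :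
  boundaryS (chain_map c) = chain_map (boundaryS c).
Proof.
apply: (@chain_ext _ _ _ (@boundaryS Y q \o @chain_map q.+1)
          (@chain_map q \o @boundaryS X q)) c => s /=.
have -> : chain_map (boundaryS (oriented s)) = bd_tuple (map_tuple f s).
  rewrite boundaryS_oriented raddf_sum; apply: eq_bigr => i _.
  rewrite raddfMz /= chain_map_tuple ?mutually_adj_face ?(valP s) //.
  congr (oriented _ *~ _).
  by apply: eq_from_tnth => k; rewrite !(tnth_mktuple, tnth_map).
rewrite chain_map_oriented.
have [u|] := boolP (uniq (map_tuple f s)).
  by rewrite boundaryS_tuple // mutually_adj_map.
move=> nu; rewrite oriented0 ?mutually_adj_map // raddf0.
have /injectivePn[a [b ab e]] : ~~ injectiveb (tnth (map_tuple f s)).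
  by apply: contra nu => /injectiveP /tuple_uniqP.
by rewrite (bd_tuple_dup ab e).
Qed.

Lemma chain_map_cycle q (c : chain X q) :
  c \in @is_cycle X q -> chain_map c \in @is_cycle Y q.
Proof.
case: q c => [|q] c; first by move=> _; exact: eqxx.
move=> /eqP h; apply/eqP; rewrite [LHS]chain_map_boundaryS.
by rewrite [boundaryS c]h raddf0.
Qed.

Definition cycle_map q (z : cycles X q) : cycles Y q :=
  Cycles (chain_map_cycle (valP z)).

Lemma cycle_map_zmod q : zmod_morphism (@cycle_map q).
Proof. by move=> x y; apply: val_inj; rewrite /= raddfB. Qed.
HB.instance Definition _ q := GRing.isZmodMorphism.Build _ _ (@cycle_map q)
  (@cycle_map_zmod q).

Definition homology_map q : homology X q -> homology Y q :=
  quot_lift (fun z => \pi_(homology Y q) (cycle_map z)).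

Let cycle_map_boundary q (z : cycles X q) :
  z \in @is_boundary X q -> \pi_(homology Y q) (cycle_map z) = 0.
Proof.
move=> /asboolP[w hw]; apply/eqP.
rewrite -[X in _ == X](raddf0 (\pi_(homology Y q))) -Quotient.idealrBE subr0.
apply/asboolP; exists (chain_map w).
by rewrite [LHS]chain_map_boundaryS [boundaryS w]hw.
Qed.

Lemma homology_mapE q (z : cycles X q) :
  homology_map (\pi_(homology X q) z) = \pi_(homology Y q) (cycle_map z).
Proof.
exact: (quot_liftE (phi := \pi_(homology Y q) \o @cycle_map q)
  (@cycle_map_boundary q)).
Qed.

Lemma homology_map_zmod q : zmod_morphism (@homology_map q).
Proof.
move=> x y; rewrite -[x]reprK -[y]reprK -raddfB !homology_mapE.
by rewrite !raddfB.
Qed.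
HB.instance Definition _ q := GRing.isZmodMorphism.Build _ _ (@homology_map q)
  (@homology_map_zmod q).

End ChainMap.

Arguments cycle_map {X Y f} fc q z.
Arguments homology_map {X Y f} fc q x.

(* Main.v *)
(** Write a continuous selfmap of [C_n] as the reduction modulo [n] of an integer
    valued lift; the total increment of the lift around the cycle is the winding
    number. For [n > 4] two maps that are pointwise adjacent or equal have the same
    winding number, because the difference of their increments is a multiple of
    [n] of absolute value at most 4. Conversely, if the winding numbers agree,
    then moving one lift towards the other at unit speed is compatible with the
    wrap around and gives a homotopy, and joining the two lifts by paths of edges
    gives a chain homotopy in degrees 0 and 1; there are no simplices in higher
    degrees. Finally the winding number is read off the image of the fundamental
    1-cycle by an additive functional on 1-chains. *)
From HB Require Import structures.
Require Import Defs.
From mathcomp Require Import all_boot all_fingroup all_algebra zify ring.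
From mathcomp.classical Require Import boolp.

Set Implicit Arguments.
Unset Strict Implicit.
Unset Printing Implicit Defensive.

Import GRing.Theory.
Local Open Scope ring_scope.
Local Open Scope quotient_scope.

(** * Discrete primitives and permutations of two points *)

Lemma int_invariant (T : Type) (F : int -> T) :
  (forall k, F (k + 1) = F k) -> forall k, F k = F 0.
Proof.
move=> FS; elim/int_rec => [//|k IH|k IH]; first by rewrite intS addrC FS.
by rewrite -(FS (- _)) intS opprD addrAC addNr add0r.
Qed.

(** Applied to the edges from [k] to [k + 1], this turns edge paths into differences of two
    values. *)
Lemma primitive_exists (M : zmodType) (phi : int -> M) :
  exists P : int -> M, forall k, P (k + 1) = P k + phi k.
Proof.
exists (fun k => match k with
  | Posz j => \sum_(i < j) phi i%:Z
  | Negz j => - \sum_(i < j.+1) phi (Negz i)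
  end).
case=> [j|[|j]]; first by rewrite -PoszD addn1 big_ord_recr.
  by rewrite (_ : Negz 0 + 1 = 0) /= ?big_ord0 ?big_ord1 ?addNr.
have -> : Negz j.+1 + 1 = Negz j by lia.
by rewrite [in RHS]big_ord_recr opprD addrNK.
Qed.

Lemma perm2P (r : 'S_2) : r = 1%g \/ r = tperm ord0 ord_max.
Proof.
have r_max : r ord_max != r ord0 by rewrite (inj_eq perm_inj).
have ord2 (i : 'I_2) : i = ord0 \/ i = ord_max.
  by case: i => [[|[|//]] ?]; [left|right]; apply: val_inj.
case: (ord2 (r ord0)) (ord2 (r ord_max)) r_max => [e|e] [e'|e'];
  rewrite e e' // => _; [left|right]; apply/permP => i;
  by case: (ord2 i) => ->; rewrite ?perm1 ?tpermL ?tpermR.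
Qed.

Lemma adjeq_sym (X : digital_image) (x y : X) : adjeq x y = adjeq y x.
Proof. by rewrite /adjeq eq_sym adj_sym. Qed.

(** * Chains of degrees 0 and 1 *)

Section LowChains.
Variable X : digital_image.
Implicit Types x y : X.

Definition vertex x : chain X 0 := oriented [tuple x].

Definition edge x y : chain X 1 := oriented [tuple x; y].

Lemma mutually_adj2 x y : mutually_adj [tuple x; y] = adj x y.
Proof.
apply/mutually_adjP/idP => [/(_ ord0 ord_max isT) //|xy].
case=> [[|[|//]] ?] [[|[|//]] ?] // _.
by rewrite adj_sym.
Qed.

Lemma edgexx x : edge x x = 0.
Proof. by rewrite /edge oriented0 // mutually_adj2 adj_irr. Qed.

Lemma edgeC x y : edge y x = - edge x y.
Proof.
rewrite /edge (oriented_perm _ (tperm ord0 ord_max)) odd_tperm mulrN1z.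
congr (- oriented _); apply: eq_from_tnth => -[[|[|//]] ?];
  by rewrite tnth_mktuple permE.
Qed.

Lemma boundary_edge x y : adj x y -> boundaryS (edge x y) = vertex y - vertex x.
Proof.
move=> xy; rewrite /edge boundaryS_tuple ?mutually_adj2 //.
rewrite /bd_tuple big_ord_recl big_ord1 /= mulrN1z.
congr (oriented _ - oriented _); apply: eq_from_tnth => i;
  by rewrite tnth_mktuple (ord1 i).
Qed.

Lemma simplex0P (s : simplex X 0) : exists x, oriented s = vertex x.
Proof.
exists (tnth s ord0); congr oriented; apply: eq_from_tnth => i.
by rewrite (ord1 i).
Qed.

Lemma simplex1P (s : simplex X 1) :
  exists x y, adj x y /\ oriented s = edge x y.
Proof.
exists (tnth s ord0), (tnth s ord_max); split.
  by have /mutually_adjP := valP s; apply.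
congr oriented; apply: eq_from_tnth => -[[|[|//]] ?];
  by rewrite /tnth /=; apply: set_nth_default; rewrite size_tuple.
Qed.

Lemma vertex_lift (M : zmodType) (phi : X -> M) :
  exists D : {additive chain X 0 -> M}, forall x, D (vertex x) = phi x.
Proof.
pose psi (s : simplex X 0) := phi (tnth s ord0).
have alt (s s' : simplex X 0) (r : 'S_1) : vertices s' = tuple_perm s r ->
    psi s = psi s' *~ (-1) ^+ r.
  have -> : r = 1%g by apply/permP => i; rewrite !ord1.
  by rewrite tuple_perm1 odd_perm1 /psi => ->.
pose D := GRing.isZmodMorphism.Build _ _ _ (chain_lift_zmod alt).
exists (HB.pack_for {additive chain X 0 -> M} (chain_lift psi) D) => x /=.
have a1 : mutually_adj [tuple x].
  by apply/mutually_adjP => i j; rewrite !ord1 eqxx.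
exact: (chain_lift_oriented alt (Simplex a1)).
Qed.

(** Antisymmetry of [phi] is compatibility with the sign of the transposition of two vertices. *)
Lemma edge_lift (M : zmodType) (phi : X -> X -> M) :
  (forall x y, phi y x = - phi x y) ->
  exists D : {additive chain X 1 -> M},
    forall x y, adj x y -> D (edge x y) = phi x y.
Proof.
move=> phiC; pose psi (s : simplex X 1) := phi (tnth s ord0) (tnth s ord_max).
have alt (s s' : simplex X 1) (r : 'S_2) : vertices s' = tuple_perm s r ->
    psi s = psi s' *~ (-1) ^+ r.
  rewrite /psi => ->; rewrite !tnth_mktuple.
  case: (perm2P r) => ->; first by rewrite !perm1 odd_perm1.
  by rewrite tpermL tpermR odd_tperm mulrN1z phiC.
pose D := GRing.isZmodMorphism.Build _ _ _ (chain_lift_zmod alt).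
exists (HB.pack_for {additive chain X 1 -> M} (chain_lift psi) D) => x y xy /=.
rewrite -mutually_adj2 in xy.
exact: (chain_lift_oriented alt (Simplex xy)).
Qed.

End LowChains.

Section LowChainMap.
Variables (X Y : digital_image) (f : X -> Y).

Lemma chain_map_vertex x : chain_map f (vertex x) = vertex (f x).
Proof.
rewrite /vertex chain_map_tuple; first by congr oriented; apply: val_inj.
by apply/mutually_adjP => i j; rewrite !ord1 eqxx.
Qed.

Lemma chain_map_edge x y : adj x y -> chain_map f (edge x y) = edge (f x) (f y).
Proof.
move=> xy; rewrite /edge chain_map_tuple ?mutually_adj2 //.
by congr oriented; apply: val_inj.
Qed.

End LowChainMap.

Section HomologyMapEq.
Variables (X Y : digital_image) (f g : X -> Y).
Hypotheses (fc : dcontinuous f) (gc : dcontinuous g).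

(** Brings the comparison of induced maps to the level of chains. *)
Lemma homology_map_eqP q :
  homology_map fc q =1 homology_map gc q <->
  forall c : chain X q, c \in @is_cycle X q ->
    exists w : chain Y q.+1, boundary w = chain_map f c - chain_map g c.
Proof.
have E (z : cycles X q) :
    homology_map fc q (\pi_(homology X q) z) =
    homology_map gc q (\pi_(homology X q) z) <->
    exists w : chain Y q.+1, boundary w = chain_map f z - chain_map g z.
  rewrite !homology_mapE; split=> [/eqP|h].
    by rewrite -Quotient.idealrBE => /asboolP.
  by apply/eqP; rewrite -Quotient.idealrBE; apply/asboolP.
split=> [h c cz|h x]; first exact: (E (Cycles cz)).1.
by rewrite -[x]reprK; apply/E/h/valP.
Qed.

End HomologyMapEq.

(** * The cycle as the integers modulo its length *)

Section Cycle.
Variable m : nat.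
(** The form [m.+2] makes the ordinals a ring, in which the successor on the cycle is [x + 1]. *)
Notation Z := 'I_m.+2.
Notation C := (digital_cycle m.+2).

Lemma val_addZ1 (x : Z) : nat_of_ord (x + 1 : Z)%R = (x.+1 %% m.+2)%N.
Proof. by rewrite /= modnDmr addn1. Qed.

(** Lifts congruences modulo [m.+2] between small integers to equalities. *)
Lemma intr_small_eq0 (k : int) : (`|k| < m.+2)%N -> k%:~R = 0 :> Z -> k = 0.
Proof.
move=> small k0; apply/eqP; rewrite -absz_eq0 -(modn_small small).
have: (`|k|%N)%:R = 0 :> Z.
  case: k k0 {small} => j; first by [].
  by rewrite NegzE rmorphN => /eqP; rewrite oppr_eq0 => /eqP.
by rewrite Zp_nat => /(congr1 val) /= ->.
Qed.

Lemma cycle_adjE (x y : Z) : adj (x : C) y = (y == x + 1) || (x == y + 1).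
Proof.
have E (a b : Z) : (b == a.+1 %[mod m.+2])%N = (b == a + 1).
  by rewrite -val_eqE [val (a + 1)]val_addZ1 [(b %% _)%N]modn_small.
have neq (a : Z) : a == a + 1 = false.
  by rewrite -subr_eq0 opprD addNKr oppr_eq0 oner_eq0.
rewrite /= /cycle_adj !E; by case: eqP => [->|] //=; rewrite neq.
Qed.

Definition step (x y : Z) : int := (y == x + 1)%:Z - (x == y + 1)%:Z.

Lemma step_bound x y : (`|step x y| <= 1)%N.
Proof. by rewrite /step; do 2!case: eqP. Qed.

Lemma stepC x y : step y x = - step x y.
Proof. by rewrite /step opprB. Qed.

Hypothesis m_gt2 : (2 < m)%N.

Lemma step_intr x y : adjeq (x : C) y -> (step x y)%:~R = y - x :> Z.
Proof.
rewrite /adjeq cycle_adjE /step rmorphB /= -!pmulrn.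
case: (y =P x + 1) => [->|_].
  case: (x =P x + 1 + 1) => [e|_]; last by rewrite subr0 addrAC subrr add0r.
  have : 2%:~R = 0 :> Z by apply: (addrI x); rewrite addr0 [RHS]e -addrA.
  by move/intr_small_eq0 => h; suff : 2 = 0 :> int by []; apply: h; lia.
case: (x =P y + 1) => [->|_]; first by rewrite sub0r opprD addNKr.
by rewrite !orbF => /eqP ->; rewrite !subrr.
Qed.

Lemma step_adj x y : adj (x : C) y -> `|step x y|%N = 1%N.
Proof.
move=> xy; have := step_bound x y; rewrite leq_eqVlt => /orP[/eqP //|].
rewrite ltnS leqn0 absz_eq0 => /eqP s0.
have : adjeq (x : C) y by rewrite /adjeq xy orbT.
move/step_intr/esym/eqP; rewrite s0 subr_eq0 => /eqP e.
by move: xy; rewrite e adj_irr.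
Qed.

(** The increments around a triangle are three signs. Their sum is a multiple of [m.+2] of absolute
    value at most 3, hence zero, against parity. *)
Lemma no_triangle (x y z : Z) :
  adj (x : C) y -> adj (y : C) z -> adj (x : C) z -> False.
Proof.
move=> xy yz xz; have [[a b] c] := (step_adj xy, step_adj yz, step_adj xz).
suff : step x y + step y z - step x z = 0 by lia.
apply: intr_small_eq0; first by lia.
rewrite rmorphB rmorphD /= !step_intr ?/adjeq ?xy ?yz ?xz ?orbT //.
by ring.
Qed.

(** * Winding number and its homotopy invariance *)

(** For continuous [f] this is [m.+2] times the usual degree. *)
Definition winding (f : Z -> Z) : int := \sum_x step (f x) (f (x + 1)).

Lemma adj_succ (x : Z) : adj (x : C) (x + 1).
Proof. by rewrite cycle_adjE eqxx. Qed.

Lemma adjeq_succ (f : C -> C) (x : Z) :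
  dcontinuous f -> adjeq (f x) (f (x + 1)).
Proof. by apply; exact: adj_succ. Qed.

Lemma winding_close (f g : C -> C) : dcontinuous f -> dcontinuous g ->
  (forall x, adjeq (f x) (g x)) -> winding f = winding g.
Proof.
(* The four increments around the square on [f x], [f (x + 1)], [g (x + 1)], [g x] cancel; the terms
   between [f] and [g] telescope in the sum over the cycle. *)
move=> fc gc fg; have sq (x : Z) :
    step (f x) (f (x + 1)) = step (g x) (g (x + 1)) + step (f x) (g x)
      - step (f (x + 1)) (g (x + 1)).
  have := step_intr (adjeq_succ x fc); have := step_intr (adjeq_succ x gc).
  have := step_intr (fg x); have := step_intr (fg (x + 1)).
  move: (step_bound (f x) (f (x + 1))) (step_bound (g x) (g (x + 1))).
  move: (step_bound (f x) (g x)) (step_bound (f (x + 1)) (g (x + 1))).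
  move: (step (f x) (f (x + 1))) (step (g x) (g (x + 1))).
  move: (step (f x) (g x)) (step (f (x + 1)) (g (x + 1))) => i j k l.
  move=> bi bj bk bl ej ei el ek.
  apply/eqP; rewrite -subr_eq0; apply/eqP/intr_small_eq0; first by lia.
  by rewrite !(rmorphB, rmorphD) /= ei ej ek el; ring.
rewrite /winding (eq_bigr _ (fun x _ => sq x)) sumrB big_split /=.
by rewrite [X in _ + X - _](reindex_inj (addIr 1)) addrK.
Qed.

Lemma homotopic_winding (f g : C -> C) : homotopic f g -> winding f = winding g.
Proof.
move=> [k _ [H [H0 Hk Ht Hx]]].
pose h t := H ^~ (inord t : 'I_k.+1).
have -> : f = h 0%N.
  by apply: funext => x; rewrite -H0 /h -[ord0]inord_val.
have -> : g = h k.
  by apply: funext => x; rewrite -Hk /h -[ord_max]inord_val.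
suff : forall t, (t <= k)%N -> winding (h 0%N) = winding (h t) by apply.
elim=> [//|t IH] tk; rewrite IH 1?ltnW //.
apply: (winding_close (Hx _) (Hx _)) => x.
by apply: Ht; rewrite /= /interval_adj !inordK; lia.
Qed.

(** * Integer lifts and the construction of homotopies *)

(** The lift sums the increments of [f] from a representative of [f 0]. Since [ord_max + 1] is 0, it
    closes up only after subtracting the winding number there. *)
Lemma lift_exists (f : C -> C) : dcontinuous f ->
  exists A : Z -> int, (forall x, (A x)%:~R = f x :> Z) /\
    forall x, A (x + 1) =
      A x + step (f x) (f (x + 1)) - (if x == ord_max then winding f else 0).
Proof.
move=> fc; pose s k := step (f (k%:R : Z)) (f (k%:R + 1 : Z)).
pose A (x : Z) : int := (f 0 : nat)%:Z + \sum_(k < x) s k.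
have ws : winding f = \sum_(k < m.+2) s k.
  by apply: eq_bigr => k _; rewrite /s natr_Zp.
exists A; split=> [x|x].
  rewrite /A -[in RHS](natr_Zp x); elim: (x : nat) => [|k IH].
    by rewrite big_ord0 addr0 -pmulrn natr_Zp.
  rewrite big_ord_recr addrA rmorphD /= IH /s step_intr ?adjeq_succ //.
  by rewrite -natr1; ring.
have sx : \sum_(k < x) s k + step (f x) (f (x + 1)) = \sum_(k < x.+1) s k.
  by rewrite big_ord_recr /= {3}/s natr_Zp.
rewrite /A -2!addrA; congr (_ + _); rewrite addrA sx.
rewrite val_addZ1; case: eqP => [->|ne].
  by rewrite modnn big_ord0 ws subrr.
rewrite subr0 modn_small // ltn_neqAle ltn_ord andbT.
by apply/eqP => e; apply: ne; apply: val_inj; case: e.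
Qed.

Lemma winding_intr (f : C -> C) : dcontinuous f -> (winding f)%:~R = 0 :> Z.
Proof.
move=> fc; rewrite rmorph_sum /=.
under eq_bigr => x _ do rewrite step_intr ?adjeq_succ //.
by rewrite sumrB [X in _ - X](reindex_inj (addIr 1)) subrr.
Qed.

Lemma adjeq_intr (i j : int) : (`|i - j| <= 1)%N ->
  adjeq (i%:~R : C) (j%:~R : Z).
Proof.
move=> ij; rewrite /adjeq cycle_adjE.
have [->|ne] := eqVneq i j; first by rewrite eqxx.
have [->|ne'] := eqVneq i (j + 1); first by rewrite rmorphD /= eqxx !orbT.
have -> : j = i + 1 by lia.
by rewrite rmorphD /= eqxx orbT.
Qed.

Lemma dcontinuous_succ (f : C -> C) :
  (forall x : Z, adjeq (f x) (f (x + 1))) -> dcontinuous f.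
Proof.
move=> h x x'; rewrite cycle_adjE => /orP[/eqP ->|/eqP ->]; first exact: h.
by rewrite adjeq_sym; exact: h.
Qed.

(* Position at time [t] of a point that moves from [a] towards [b] at unit speed
   and stops there. *)
Definition clamp (a b : int) (t : nat) : int :=
  if b < a - t%:Z then a - t%:Z else if a + t%:Z < b then a + t%:Z else b.

Lemma winding_homotopic (f g : C -> C) : dcontinuous f -> dcontinuous g ->
  winding f = winding g -> homotopic f g.
Proof.
move=> fc gc fg; have [A [Af AS]] := lift_exists fc.
have [B [Bg BS]] := lift_exists gc.
(* At time [k] every point has arrived; the length [k.+1] is positive even when the lifts
   coincide. *)
pose k := (\max_x `|A x - B x|)%N.
exists k.+1 => //.
exists (fun x t => (clamp (A x) (B x) (t : 'I_k.+2))%:~R : Z).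
split=> [x|x|x s t|t].
- by rewrite -Af; congr (_%:~R); rewrite /clamp /=; do 2?case: ifP; lia.
- have : (`|A x - B x| <= k)%N by exact: (leq_bigmax x).
  by rewrite -Bg => ?; congr (_%:~R); rewrite /clamp /=; do 2?case: ifP; lia.
- rewrite /= /interval_adj => st; apply: adjeq_intr.
  rewrite /clamp; repeat case: ifP; lia.
apply: dcontinuous_succ => x; rewrite AS BS -fg.
set c := if _ then _ else _; have c0 : c%:~R = 0 :> Z.
  by rewrite /c; case: ifP => // _; exact: winding_intr.
move: (step_bound (f x) (f (x + 1))) (step_bound (g x) (g (x + 1))).
move: (A x) (B x) (step _ _) (step _ _) => a b j i bi bj.
(* [clamp] commutes with a common translation, so the jump [c] at the wrap around disappears modulo
   [m.+2]. *)
have -> : clamp (a + i - c) (b + j - c) (t : 'I_k.+2) =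
          clamp (a + i) (b + j) (t : 'I_k.+2) - c.
  by rewrite /clamp; repeat case: ifP; lia.
rewrite rmorphB /= c0 subr0; apply: adjeq_intr.
(* Moving both ends by at most 1 moves [clamp], the median of [a - t], [b] and [a + t], by at most
   1. *)
rewrite /clamp; repeat case: ifP; lia.
Qed.

(** * Homology of the cycle and the winding number *)

Lemma simplex_ge2_absurd q : simplex C q.+2 -> False.
Proof.
move=> s; have /mutually_adjP adjs := valP s.
exact: (no_triangle (adjs (@Ordinal q.+3 0 isT) (@Ordinal q.+3 1 isT) isT)
  (adjs (@Ordinal q.+3 1 isT) (@Ordinal q.+3 2 isT) isT)
  (adjs (@Ordinal q.+3 0 isT) (@Ordinal q.+3 2 isT) isT)).
Qed.

Lemma chain_ge2_eq0 q (c : chain C q.+2) : c = 0.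
Proof.
apply: (@chain_ext _ _ _ idfun \0) c => s.
by case: (simplex_ge2_absurd s).
Qed.

Lemma chain1_ext (M : zmodType) (phi psi : {additive chain C 1 -> M}) :
  (forall x : Z, phi (edge (x : C) (x + 1)) = psi (edge (x : C) (x + 1))) ->
  phi =1 psi.
Proof.
move=> h; apply: chain_ext => s; have [x [y [xy ->]]] := simplex1P s.
move: xy; rewrite cycle_adjE => /orP[/eqP ->|/eqP ->]; first exact: h.
by rewrite edgeC !raddfN h.
Qed.

(** These are the chain homotopy identities whose component from 1-chains to 2-chains is zero. *)
Lemma winding_chain_homotopy (f g : C -> C) :
  dcontinuous f -> dcontinuous g -> winding f = winding g ->
  exists D : {additive chain C 0 -> chain C 1},
    (forall c, boundaryS (D c) = chain_map f c - chain_map g c) /\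
    (forall c, D (boundaryS c) = chain_map f c - chain_map g c).
Proof.
move=> fc gc fg; have [A [Af AS]] := lift_exists fc.
have [B [Bg BS]] := lift_exists gc.
(* [P b - P a] is the chain of the edge path from [a] to [b], projected to the
   cycle; hence [D] sends a vertex [x] to the path from [g x] to [f x] determined
   by the lifts. *)
have [P PS] := primitive_exists
  (fun k : int => edge (k%:~R : C) (k%:~R + 1 : Z)).
have [D Dv] := vertex_lift (X := C) (fun x => P (A x) - P (B x)).
exists D; split=> c.
  apply: (@chain_ext _ _ _ (@boundaryS C 0 \o D)
            (@chain_map _ _ f 0 \- @chain_map _ _ g 0)) c => s /=.
  have [x ->] := simplex0P s; rewrite Dv raddfB !chain_map_vertex /=.
  (* The constant of integration [t] cancels in [P (A x) - P (B x)]. *)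
  have [t bP] : exists t, forall k, boundaryS (P k) = vertex (k%:~R : C) + t.
    pose F k := boundaryS (P k) - vertex (k%:~R : C).
    exists (F 0) => k; rewrite -(int_invariant (F := F) _ k); last first.
      move=> {}k; rewrite /F PS raddfD /= boundary_edge ?adj_succ //.
      by rewrite rmorphD /= addrA addrAC addrK.
    by rewrite /F [RHS]addrC subrK.
  rewrite (bP (A x)) (bP (B x)) Af Bg.
  by rewrite opprD addrACA subrr addr0.
apply: (@chain1_ext _ (D \o @boundaryS C 0)
          (@chain_map _ _ f 1 \- @chain_map _ _ g 1)) c => x /=.
rewrite boundary_edge ?adj_succ // raddfB !Dv !chain_map_edge ?adj_succ //.
have P_edge (a i : int) (y : Z) : (`|i| <= 1)%N -> (a + i)%:~R = y ->
    P (a + i) - P a = edge (a%:~R : C) y.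
  move=> bi <-; have [-> | [-> | ->]] : i = 0 \/ i = 1 \/ i = -1 by lia.
  - by rewrite addr0 subrr edgexx.
  - by rewrite PS addrAC subrr add0r rmorphD.
  have := PS (a - 1); rewrite subrK => ->.
  by rewrite opprD addrA subrr sub0r -edgeC rmorphB /= subrK.
rewrite AS BS -fg; set w := if _ then _ else _; have w0 : w%:~R = 0 :> Z.
  by rewrite /w; case: ifP => // _; exact: winding_intr.
(* [P] is quasi-periodic with period [w], a multiple of [m.+2]. *)
have [t shift] : exists t, forall a, P (a - w) = P a + t.
  pose F a := P (a - w) - P a.
  exists (F 0) => a; rewrite -(int_invariant (F := F) _ a); last first.
    move=> k; rewrite /F addrAC !PS rmorphB /= w0 subr0.
    by rewrite opprD addrACA subrr addr0.
  by rewrite /F [RHS]addrC subrK.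
have lf : (A x + step (f x) (f (x + 1)))%:~R = f (x + 1) :> Z.
  by rewrite -[RHS]Af AS -/w rmorphB /= w0 subr0.
have lg : (B x + step (g x) (g (x + 1)))%:~R = g (x + 1) :> Z.
  by rewrite -[RHS]Bg BS -fg -/w rmorphB /= w0 subr0.
rewrite -(Af x) -(Bg x) -(P_edge _ _ _ (step_bound _ _) lf).
rewrite -(P_edge _ _ _ (step_bound _ _) lg) !Af !Bg.
(* Both lifts jump by the same [w], so the two copies of [t] cancel. *)
rewrite !shift; move: (P (A x + _)) (P (B x + _)) (P (A x)) (P (B x)).
move=> p q r u; rewrite [q + t]addrC addrKA !opprB addrACA [RHS]addrACA.
by rewrite [- q - r]addrC.
Qed.

Lemma winding_homology (f g : C -> C)
    (fc : dcontinuous f) (gc : dcontinuous g) :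
  winding f = winding g -> forall q, homology_map fc q =1 homology_map gc q.
Proof.
move=> fg q; apply/homology_map_eqP => c cz.
have [D [D0 D1]] := winding_chain_homotopy fc gc fg.
case: q c cz => [|[|q]] c /eqP cz; first by exists (D c); exact: D0.
  by exists 0; rewrite raddf0 -D1 [boundaryS c]cz raddf0.
by exists 0; rewrite [c]chain_ge2_eq0 !raddf0 addr0.
Qed.

Lemma homology_winding (f g : C -> C)
    (fc : dcontinuous f) (gc : dcontinuous g) :
  homology_map fc 1 =1 homology_map gc 1 -> winding f = winding g.
Proof.
move/homology_map_eqP => h.
pose z : chain C 1 := \sum_(x : Z) edge (x : C) (x + 1).
have [|w] := h z.
  apply/eqP; rewrite raddf_sum /=.
  under eq_bigr => x _ do rewrite boundary_edge ?adj_succ //.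
  by rewrite sumrB [X in _ - X](reindex_inj (addIr 1)) subrr.
(* There are no 2-chains, so the images of the fundamental cycle [z] agree as chains. *)
rewrite [w]chain_ge2_eq0 raddf0 => /esym/eqP; rewrite subr_eq0 => /eqP fgz.
have [W We] := edge_lift (X := C) stepC.
have windingE (k : C -> C) : dcontinuous k -> W (chain_map k z) = winding k.
  move=> kc; rewrite [chain_map _ _]raddf_sum raddf_sum.
  apply: eq_bigr => x _; rewrite /= chain_map_edge ?adj_succ //.
  have := adjeq_succ x kc; rewrite /adjeq => /orP[/eqP <-|/We //].
  (* A collapsed edge is the zero chain, and its increment vanishes by antisymmetry. *)
  rewrite edgexx raddf0; apply/esym; have := stepC (k x) (k x); lia.
by rewrite -!windingE // fgz.
Qed.

End Cycle.

Local Close Scope ring_scope.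

Theorem corollary4p8 (n : nat) (hn : 4 < n)
    (f g : digital_cycle n -> digital_cycle n)
    (hf : dcontinuous f) (hg : dcontinuous g) :
  (forall q : nat, homology_map hf q =1 homology_map hg q) <-> homotopic f g.
Proof.
case: n hn f g hf hg => [|[|m]] //; rewrite !ltnS => hm f g fc gc.
split=> [h|h].
  exact: (winding_homotopic hm fc gc (homology_winding hm (h 1%N))).
exact: (winding_homology hm fc gc (homotopic_winding hm h)).
Qed.
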